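(* Let $X$ be a complex Banach space, let $\mathfrak A$ be a subalgebra of $\mathcal L(X)$, and let $n\geq 1$ be an integer. Then either $\mathfrak A$ has a non-trivial invariant injective operator range of order $n$, or $\mathfrak A$ is $n$-transitive.
   Context: $\mathcal L(X)$ is the algebra of all bounded linear operators on $X$; a subalgebra need not be unital or closed. A linear subspace $Y\subseteq X$ is an injective operator range of order $n$ if there are a closed subspace $\mathcal M\subseteq X^n$ and a one-to-one bounded linear operator $\vec T\colon\mathcal M\to X$ with $Y=\operatorname{Range}\vec T$. $Y$ is invariant for $\mathfrak A$ if $AY\subseteq Y$ for all $A\in\mathfrak A$, and non-trivial if $Y\neq\{0\}$ and $Y\neq X$. $\mathfrak A$ is $n$-transitive if for every linearly independent $n$-tuple $(x_1,\dots,x_n)\in X^n$ the set $\{(Ax_1,\dots,Ax_n)\mid A\in\mathfrak A\}$ is dense in $X^n$.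
   Formalization: The case n = 1, dim X = 1, 𝔄 = {0} is excluded, because there the claim fails: X has no non-trivial linear subspace, and {0} is not 1-transitive. *)

(* Defs.v *)
From HB Require Import structures.
From mathcomp Require Import all_boot all_order all_algebra.
From mathcomp Require Import all_classical all_reals all_analysis.
From mathcomp Require Export complex.

Set Implicit Arguments.
Unset Strict Implicit.
Unset Printing Implicit Defensive.

Import Order.TTheory GRing.Theory Num.Theory.
Import numFieldNormedType.Exports.

Local Open Scope classical_set_scope.
Local Open Scope ring_scope.

Section Definitions.
Variables (K : numFieldType) (X : normedModType K).

Definition bounded_operator : set (X -> X) :=
  [set T | linear T /\ exists C : K, forall x, `|T x| <= C * `|x|].

(* The power X^n is {ptws 'I_n -> X}: pointwise operations and the product
   topology. *)

Definition linear_subspace (V : lmodType K) (M : set V) : Prop :=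
  M 0 /\ forall (a : K) (u v : V), M u -> M v -> M (a *: u + v).

(* An operator defined on M only is represented by a total function, whose
   values outside M are irrelevant. Any of the usual equivalent norms could be
   used on X^n; this is the l^1 one. *)
Definition bounded_operator_on (n : nat) (M : set {ptws 'I_n -> X})
    (T : {ptws 'I_n -> X} -> X) : Prop :=
  (forall (a : K) (u v : {ptws 'I_n -> X}),
      M u -> M v -> T (a *: u + v) = a *: T u + T v) /\
  exists C : K, forall u, M u -> `|T u| <= C * \sum_(i < n) `|u i|.

Definition injective_operator_range (n : nat) (Y : set X) : Prop :=
  exists (M : set {ptws 'I_n -> X}) (T : {ptws 'I_n -> X} -> X),
    [/\ closed M, linear_subspace M, bounded_operator_on M T,
        set_inj M T & Y = T @` M].

Definition is_subalgebra (A : set (X -> X)) : Prop :=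
  [/\ A `<=` bounded_operator,
      linear_subspace A &
      forall S T, A S -> A T -> A (S \o T)].

Definition invariant_under (A : set (X -> X)) (Y : set X) : Prop :=
  forall T, A T -> T @` Y `<=` Y.

Definition nontrivial (Y : set X) : Prop := Y <> [set 0] /\ Y <> setT.

Definition linearly_independent (n : nat) (x : 'I_n -> X) : Prop :=
  forall c : 'I_n -> K, \sum_(i < n) c i *: x i = 0 -> forall i, c i = 0.

Definition n_transitive (n : nat) (A : set (X -> X)) : Prop :=
  forall x : 'I_n -> X, linearly_independent x ->
    dense [set v : {ptws 'I_n -> X} | exists2 T, A T & v = fun i => T (x i)].

Definition one_dimensional : Prop :=
  exists2 e : X, e != 0 & forall x, exists a : K, x = a *: e.

(* The zero algebra on a one-dimensional space is not 1-transitive, although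
   the space has no non-trivial linear subspace at all: the only case in which
   the dichotomy fails. *)
Definition degenerate (n : nat) (A : set (X -> X)) : Prop :=
  [/\ n = 1%N, one_dimensional & A = [set 0]].

End Definitions.

Arguments bounded_operator {K} X.
Arguments one_dimensional {K} X.

(* Main.v *)
(* Let W be the closure in X^n of the vectors (T x_1, ..., T x_n), T in A, and
   let J be a minimal set of coordinates whose projection is injective on W. For
   j in J, the vectors of W vanishing on J minus j form a closed invariant
   subspace on which the j-th coordinate is injective; its range is an invariant
   injective operator range of order n, hence equal to X. So if J contains all
   coordinates then W = X^n. Otherwise a coordinate i outside J is given on W by
   w_i = sum_(j in J) S_j w_j with operators S_j that commute with A and are
   bounded by the closed graph theorem. A bounded S commuting with A is scalar:
   otherwise the kernel and the range of every S - a, being invariant operator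
   ranges, are 0 and X, and S would have empty spectrum. Hence every T in A
   kills x_i - sum_j a_j x_j for some scalars a_j; as the common kernel of A is
   trivial, the x_k are linearly dependent.

   That the spectrum is non-empty is proved by Rickart's elementary argument. If
   all l - T were invertible, then G_N(l) = l^N (l^N - T^N)^-1, an average of
   rotations of l (l - T)^-1, would be Lipschitz in l on discs uniformly in N.
   For large l, G_N(l) tends to the identity and T^N / l^N to 0; by uniformity
   this persists when l decreases to 0, where G_N(0) = 0. *)

Require Import Defs.
From HB Require Import structures.
From mathcomp Require Import all_boot all_order all_algebra.
From mathcomp Require Import all_classical all_reals all_analysis.
From mathcomp Require Import ring lra.
Import Order.TTheory GRing.Theory Num.Theory.
Import numFieldNormedType.Exports.
Local Open Scope classical_set_scope.
Local Open Scope ring_scope.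
Local Open Scope complex_scope.

Set Implicit Arguments.
Unset Strict Implicit.
Unset Printing Implicit Defensive.

(** * Real-valued norms and geometric convergence *)

Section LinearFunctions.
Context {K : pzRingType} {V : lmodType K}.
Implicit Types (f : V -> V).

Lemma linear_addE f : linear f -> forall x y, f (x + y) = f x + f y.
Proof. by move=> f_lin x y; have := f_lin 1 x y; rewrite !scale1r. Qed.

Lemma linear_subE f : linear f -> forall x y, f (x - y) = f x - f y.
Proof. exact: GRing.zmod_morphism_linear. Qed.

Lemma linear_scaleE f : linear f -> forall a x, f (a *: x) = a *: f x.
Proof. exact: GRing.scalable_linear. Qed.

Lemma linear_0E f : linear f -> f 0 = 0.
Proof. by move=> f_lin; have := linear_subE f_lin 0 0; rewrite !subrr. Qed.

Lemma iter_linear f N : linear f -> linear (iter N f).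
Proof. by move=> f_lin; elim: N => [|N IH] a x y //=; rewrite IH f_lin. Qed.

End LinearFunctions.

Section RealNorm.
Context {R : realType} {X : normedModType R[i]}.
Implicit Types (x y : X) (a b : R[i]) (r : R).

(* Norms take values in R[i]; [modulus] and [nm] are their real-valued
   versions, on which linear arithmetic is available. *)
Definition modulus a : R := complex.Re `|a|.

Definition nm x : R := complex.Re `|x|.

Lemma norm_modulus a : `|a| = (modulus a)%:C.
Proof. by rewrite /modulus RRe_real // normr_real. Qed.

Lemma modulus_real r : modulus r%:C = `|r|.
Proof.
apply: complexI; rewrite -norm_modulus normc_def /= expr0n addr0.
by rewrite sqrtr_sqr.
Qed.

Lemma modulusM a b : modulus (a * b) = modulus a * modulus b.
Proof. by apply: complexI; rewrite rmorphM /= -!norm_modulus normrM. Qed.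

Lemma modulusX a k : modulus (a ^+ k) = modulus a ^+ k.
Proof. by apply: complexI; rewrite rmorphXn /= -!norm_modulus normrX. Qed.

Lemma modulus_ge0 a : 0 <= modulus a.
Proof. by rewrite -lecR -norm_modulus normr_ge0. Qed.

Lemma modulusN a : modulus (- a) = modulus a.
Proof. by rewrite /modulus normrN. Qed.

Lemma modulus1 : modulus 1 = 1.
Proof. by rewrite /modulus normr1. Qed.

Lemma modulus0 : modulus 0 = 0.
Proof. by rewrite /modulus normr0. Qed.

Lemma modulus_half : modulus 2^-1 = 1 / 2.
Proof.
have -> : (2^-1 : R[i]) = (2^-1)%:C by rewrite fmorphV rmorph_nat.
by rewrite modulus_real ger0_norm ?invr_ge0 ?ler0n // mul1r.
Qed.

Lemma normE x : `|x| = (nm x)%:C.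
Proof. by rewrite /nm RRe_real // normr_real. Qed.

Lemma nm_ge0 x : 0 <= nm x.
Proof. by rewrite -lecR -normE normr_ge0. Qed.

Lemma nmD x y : nm (x + y) <= nm x + nm y.
Proof. by rewrite -lecR rmorphD /= -!normE ler_normD. Qed.

Lemma nmN x : nm (- x) = nm x.
Proof. by rewrite /nm normrN. Qed.

Lemma nmB x y : nm (x - y) = nm (y - x).
Proof. by rewrite -nmN opprB. Qed.

Lemma nmBD x y z : nm (x - z) <= nm (x - y) + nm (y - z).
Proof. by apply: le_trans (nmD _ _); rewrite addrA subrK. Qed.

Lemma nm0 : nm 0 = 0.
Proof. by rewrite /nm normr0. Qed.

Lemma nm_eq0 x : nm x = 0 -> x = 0.
Proof. by move=> x0; apply/eqP; rewrite -normr_eq0 normE x0. Qed.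

Lemma nmZ a x : nm (a *: x) = modulus a * nm x.
Proof. by apply: complexI; rewrite rmorphM /= -norm_modulus -!normE normrZ. Qed.

Lemma nm_gt0 x : x != 0 -> 0 < nm x.
Proof.
move=> x0; rewrite lt_neqAle nm_ge0 andbT; apply: contraNneq x0 => x0.
by apply/eqP/nm_eq0.
Qed.

Lemma nm_lt_eq0 x : (forall e, 0 < e -> nm x < e) -> x = 0.
Proof.
by move=> h; apply/eqP/contraT => /nm_gt0 /h; rewrite ltxx.
Qed.

(** When [X] is zero, [c] need not be real, but [c] times the norm of [x] dominates a norm, hence is
    nonnegative and equals its own modulus. *)
Lemma bounded_real (f : X -> X) :
  (exists c : R[i], forall x, `|f x| <= c * `|x|) ->
  exists2 c : R, 0 <= c & forall x, nm (f x) <= c * nm x.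
Proof.
case=> c hc; exists (modulus c); first exact: modulus_ge0.
move=> x; rewrite -lecR -normE rmorphM /= -norm_modulus -normE.
have h := hc x; apply: le_trans h _.
have : 0 <= c * `|x| by apply: le_trans (normr_ge0 _) (hc _).
by move=> /ger0_norm <-; rewrite normrM normr_id.
Qed.

End RealNorm.

Section Completeness.
Context {R : realType} {X : completeNormedModType R[i]}.

Lemma geometric_lt (C e : R) : 0 < e -> exists k, C * (1 / 2) ^+ k < e.
Proof.
move=> e0; have [C0|C0] := leP C 0.
  by exists 0%N; rewrite expr0 mulr1; lra.
have : (fun k => (1 / 2 : R) ^+ k) @ \oo --> (0 : R).
  by apply: cvg_expr; rewrite ger0_norm; lra.
move/cvgrPdist_lt => /(_ (e / C)); rewrite divr_gt0 // => /(_ isT) [k _ hk].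
exists k; have := hk k (leqnn k); rewrite sub0r normrN ger0_norm.
  by rewrite ltr_pdivlMr // mulrC.
by apply: exprn_ge0; lra.
Qed.

Lemma geometric_eq0 (z : X) (C : R) :
  (forall k, nm z <= C * (1 / 2) ^+ k) -> z = 0.
Proof.
move=> hz; apply: nm_lt_eq0 => e /(geometric_lt C)[k].
exact: le_lt_trans (hz k).
Qed.

(** The tail beyond [k] is dominated by a geometric series with sum [2 * C * (1 / 2) ^+ k]; keeping
    this rate lets later arguments avoid limits. *)
Lemma geometric_cvg (u : nat -> X) (C : R) :
  (forall k, nm (u k.+1 - u k) <= C * (1 / 2) ^+ k) ->
  exists x, forall k, nm (u k - x) <= 2 * C * (1 / 2) ^+ k.
Proof.
move=> hu.
have C0 : 0 <= C by have := hu 0%N; have := nm_ge0 (u 1%N - u 0%N); lra.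
have pow0 k : 0 <= (1 / 2 : R) ^+ k by apply: exprn_ge0; lra.
have tele k m : nm (u (k + m)%N - u k) <=
    2 * C * (1 / 2) ^+ k - 2 * C * (1 / 2) ^+ (k + m).
  elim: m => [|m IH]; first by rewrite addn0 !subrr nm0.
  apply: le_trans (nmBD _ (u (k + m)%N) _) _; rewrite addnS.
  have := hu (k + m)%N; rewrite exprS; lra.
have tele' k l : (k <= l)%N -> nm (u l - u k) <= 2 * C * (1 / 2) ^+ k.
  move=> /subnKC <-; apply: le_trans (tele _ _) _.
  have : 0 <= 2 * C * (1 / 2) ^+ (k + (l - k)) by rewrite mulr_ge0 //; lra.
  lra.
have : cvg (u @ \oo).
  apply/cauchy_cvgP/cauchyP => e e0.
  have er : e = (complex.Re e)%:C by rewrite RRe_real // gtr0_real.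
  rewrite er in e0 *; rewrite ltcR in e0.
  have [k hk] := geometric_lt (2 * C) e0.
  exists (u k); exists k => // l /= kl.
  rewrite -ball_normE /= normE ltcR nmB.
  exact: le_lt_trans (tele' _ _ kl) hk.
case/cvg_ex => x /= ux; exists x => k.
apply/ler_addgt0Pr => e e0.
have /cvgrPdist_lt/(_ e%:C) := ux.
rewrite ltcR => /(_ e0) [N _ hN].
have := hN (maxn k N) (leq_maxr _ _); rewrite normE ltcR.
have := tele' _ _ (leq_maxl k N).
have := nmBD (u k) (u (maxn k N)) x; rewrite [nm (u k - u _)]nmB.
rewrite [nm (x - _)]nmB; lra.
Qed.

End Completeness.

(** * The closed graph theorem *)

Section BoundedSeminorm.
Context {R : realType} {X : completeNormedModType R[i]}.
Variable p : X -> R.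
Hypothesis p_add : forall x y, p (x + y) <= p x + p y.
Hypothesis p_scale : forall a x, p (a *: x) = modulus a * p x.

Let pB x y : p (x - y) <= p x + p y.
Proof.
apply: le_trans (p_add _ _) _; rewrite -scaleN1r p_scale modulusN modulus1.
by rewrite mul1r.
Qed.

Let p0 : p 0 = 0.
Proof. by rewrite -(scale0r 0) p_scale modulus0 mul0r. Qed.

(** Baire's argument: otherwise there are nested balls, the one chosen after stage [m] avoiding all
    [z] with [p z <= m]; at their common point [p] would exceed every integer. *)
Lemma sublevel_somewhere_dense : exists (m : nat) (a : X) (r : R), 0 < r /\
  forall y, nm (y - a) <= r -> forall e, 0 < e ->
  exists2 z, p z <= m%:R & nm (y - z) < e.
Proof.
apply: contrapT => nodense.
have step (s : nat * (X * R)) : exists t : X * R, 0 < s.2.2 ->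
    [/\ 0 < t.2, t.2 <= s.2.2 / 2, nm (t.1 - s.2.1) <= s.2.2 / 2
      & forall z, p z <= s.1%:R -> t.2 < nm (t.1 - z)].
  case: s => m [a r] /=; have [r0|] := boolP (0 < r); last first.
    by move=> _; exists (a, r).
  apply: contrapT => nt; apply: nodense; exists m, a, (r / 2).
  split; first by rewrite divr_gt0.
  move=> y ya e e0; apply: contrapT => nz; apply: nt.
  exists (y, Num.min (r / 2) (e / 2)) => _ /=; split=> //.
  - by rewrite lt_min !divr_gt0.
  - by rewrite ge_min lexx.
  - move=> z pz; rewrite gt_min; apply/orP; right.
    rewrite ltNge; apply/negP => yz; apply: nz; exists z => //; lra.
have [f hf] := choice step.
pose v := fix v k := if k is k'.+1 then f (k', v k') else (0, 1) : X * R.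
have v_gt0 k : 0 < (v k).2.
  by elim: k => [|k IH] /=; [exact: ltr01|case: (hf (k, v k) IH)].
have vS k := hf (k, v k) (v_gt0 k).
have v2 k : (v k).2 <= (1 / 2) ^+ k.
  elim: k => [|k IH]; first by rewrite expr0.
  case: (vS k) => _ + _ _; rewrite exprS /=; lra.
have [|x hx] := @geometric_cvg _ _ (fun k => (v k).1) (1 / 2).
  by move=> k; case: (vS k) => _ _ + _ /=; have := v2 k; lra.
have nest k l : nm ((v (k + l)%N).1 - (v k).1) <= (v k).2 - (v (k + l)%N).2.
  elim: l => [|l IH]; first by rewrite addn0 !subrr nm0.
  rewrite addnS; have [_ /=] := vS (k + l)%N.
  have := nmBD (v (k + l).+1).1 (v (k + l)%N).1 (v k).1; rewrite /=; lra.
have hxk k : nm ((v k).1 - x) <= (v k).2.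
  apply/ler_addgt0Pr => e e0; have [l hl] := geometric_lt (2 * (1 / 2)) e0.
  have := hx (k + l)%N; have := nest k l; have := v_gt0 (k + l)%N.
  have := nmBD (v k).1 (v (k + l)%N).1 x; rewrite [nm ((v k).1 - (v _).1)]nmB.
  have le_l : (1 / 2 : R) ^+ (k + l) <= (1 / 2) ^+ l.
    rewrite exprD; apply: ler_piMl; first by apply: exprn_ge0; lra.
    by apply: exprn_ile1; lra.
  move: (_ ^+ (k + l)) (_ ^+ l) le_l hl => q q' /=; lra.
have [m hm] : exists m : nat, p x <= m%:R.
  by exists (Num.truncn (p x)).+1; exact/ltW/truncnS_gt.
have [_ _ _ /(_ x hm)] := vS m.
by rewrite /= ltNge; have /= -> := hxk m.+1.
Qed.

(* Zabreiko's lemma; countable subadditivity is only required along series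
   dominated by a geometric one. *)
Lemma countably_subadditive_bounded (D : R) :
  (forall (u : nat -> X) x C m, (forall k, nm (u k - x) <= C * (1 / 2) ^+ k) ->
     p (u 0%N) <= m -> (forall k, p (u k.+1 - u k) <= m * (1 / 2) ^+ k) ->
     p x <= D * m) ->
  exists2 C, 0 <= C & forall x, p x <= C * nm x.
Proof.
move=> p_sub.
have [m [a [r [r0 dense_a]]]] := sublevel_somewhere_dense.
(* The sublevel set is symmetric and convex, and [x] is half the difference of [a + x] and [a - x],
   so density moves from [a] to the origin. *)
have dense_0 x : nm x <= r -> forall e, 0 < e ->
    exists2 z, p z <= m%:R & nm (x - z) < e.
  move=> xr e e0.
  have [|z1 pz1 hz1] := dense_a (a + x) _ e e0.
    by rewrite addrAC subrr add0r.
  have [|z2 pz2 hz2] := dense_a (a - x) _ e e0.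
    by rewrite addrAC subrr add0r nmN.
  exists (2^-1 *: (z1 - z2)).
    rewrite p_scale modulus_half; have := pB z1 z2; lra.
  have -> : x - 2^-1 *: (z1 - z2) = 2^-1 *: ((a + x - z1) - (a - x - z2)).
    rewrite -{1}[x]scale1r -[X in X *: x](@mulVf _ 2) ?pnatr_eq0 //.
    rewrite -scalerA -scalerBr scaler_nat mulr2n; congr (_ *: _).
    rewrite !opprD !opprK !addrA [RHS](ACl ((1*4)*(2*5)*3*6))%AC /=.
    by rewrite subrr add0r.
  rewrite nmZ modulus_half; have := nmD (a + x - z1) (- (a - x - z2)).
  rewrite nmN; lra.
have dense_s (s : R) x : 0 < s -> nm x <= s * r -> forall e, 0 < e ->
    exists2 z, p z <= s * m%:R & nm (x - z) < e.
  move=> s0 xs e e0.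
  have s0' : s%:C != 0 by rewrite (inj_eq (@complexI _)) gt_eqF.
  have msV : modulus (s%:C^-1) = s^-1.
    by rewrite -fmorphV modulus_real ger0_norm // invr_ge0 ltW.
  have ms : modulus s%:C = s by rewrite modulus_real gtr0_norm.
  have [||z pz hz] := dense_0 (s%:C^-1 *: x) _ (e / s); last first.
  - exists (s%:C *: z); first by rewrite p_scale ms ler_wpM2l // ltW.
    have -> : x - s%:C *: z = s%:C *: (s%:C^-1 *: x - z).
      by rewrite scalerBr scalerA mulfV // scale1r.
    by rewrite nmZ ms mulrC -ltr_pdivlMr.
  - by rewrite divr_gt0.
  - by rewrite nmZ msV mulrC ler_pdivrMr // mulrC.
(* Successive approximation from [u 0 = 0]: at stage [k] the remainder has norm at most
   [r * (1 / 2) ^+ k], and a correction with [p] at most [m%:R * (1 / 2) ^+ k] halves that bound. *)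
have ball x : nm x <= r -> p x <= D * m%:R.
  move=> xr.
  have pow0 k : 0 < (1 / 2 : R) ^+ k by apply: exprn_gt0; lra.
  have step (s : nat * X) : exists t : X,
      nm (x - s.2) <= r * (1 / 2) ^+ s.1 ->
      nm (x - t) <= r * (1 / 2) ^+ s.1.+1 /\
      p (t - s.2) <= m%:R * (1 / 2) ^+ s.1.
    case: s => k y /=; have [hy|] := boolP (nm (x - y) <= r * (1 / 2) ^+ k);
      last by exists 0.
    rewrite mulrC in hy.
    have [|z pz hz] := dense_s _ _ (pow0 k) hy (r * (1 / 2) ^+ k.+1).
      by rewrite mulr_gt0.
    exists (y + z) => _; split; last by rewrite addrAC subrr add0r mulrC.
    by rewrite opprD addrA ltW.
  have [f hf] := choice step.
  pose u := fix u k := if k is k'.+1 then f (k', u k') else 0 : X.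
  have hu k : nm (x - u k) <= r * (1 / 2) ^+ k.
    elim: k => [|k IH]; first by rewrite expr0 mulr1 subr0.
    by case: (hf (k, u k) IH).
  apply: (p_sub u x r) => [k||k]; first by rewrite nmB.
  - by rewrite p0 ler0n.
  - by case: (hf (k, u k) (hu k)).
have Dm0 : 0 <= D * m%:R.
  by apply: le_trans (ball 0 _); rewrite ?p0 ?nm0 // ltW.
exists (D * m%:R / r); first by rewrite divr_ge0 // ltW.
move=> x; have [->|x0] := eqVneq x 0; first by rewrite p0 nm0 mulr0.
have nx := nm_gt0 x0.
have mr : modulus (r / nm x)%:C = r / nm x.
  by rewrite modulus_real gtr0_norm // divr_gt0.
have := ball ((r / nm x)%:C *: x).
rewrite nmZ p_scale mr -mulrA mulVf ?gt_eqF // mulr1 lexx => /(_ isT).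
rewrite -ler_pdivlMl ?divr_gt0 // invf_div => /le_trans; apply.
by rewrite mulrAC [nm x * _]mulrC mulrAC.
Qed.

End BoundedSeminorm.

Section ClosedGraph.
Context {R : realType} {X : completeNormedModType R[i]}.

(** Zabreiko's lemma is applied to the sum of the norms of the [S i x]. Closedness is assumed for
    the family jointly: it is the closed graph of a map from [X] to a power of [X]. *)
Lemma closed_graph_bounded (I : finType) (S : I -> X -> X) :
  (forall i, linear (S i)) ->
  (forall (u : nat -> X) x (y : I -> X) (C D : R),
     (forall k, nm (u k - x) <= C * (1 / 2) ^+ k) ->
     (forall i k, nm (S i (u k) - y i) <= D * (1 / 2) ^+ k) ->
     forall i, S i x = y i) ->
  exists2 C, 0 <= C & forall i x, nm (S i x) <= C * nm x.
Proof.
move=> S_lin S_closed.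
have SB i := linear_subE (S_lin i).
have SZ i := linear_scaleE (S_lin i).
have SD i := linear_addE (S_lin i).
pose p x := \sum_i nm (S i x).
have Sp i x : nm (S i x) <= p x.
  by rewrite /p (bigD1 i) //= lerDl sumr_ge0 // => j _; exact: nm_ge0.
(* The 3 for each index: [y i] is within [2 * m] of [S i (u 0)], whose norm is at most [m]. *)
have [|||C C0 hC] := @countably_subadditive_bounded _ _ p _ _
    (#|I|%:R * 3); last first.
- by exists C => // i x; exact: le_trans (Sp i x) (hC x).
- move=> u x C m ux pu0 pu.
  have /choice[y hy] : forall i, exists yi, forall k,
      nm (S i (u k) - yi) <= 2 * m * (1 / 2) ^+ k.
    move=> i.
    apply: geometric_cvg => k; rewrite -SB.
    exact: le_trans (Sp _ _) (pu k).
  have Sx := S_closed u x y C (2 * m) ux hy.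
  rewrite /p -mulrA mulr_natl -sumr_const; apply: ler_sum => i _.
  rewrite Sx; have := nmD (y i - S i (u 0%N)) (S i (u 0%N)).
  rewrite subrK nmB; have := hy i 0%N; have := Sp i (u 0%N).
  rewrite expr0; lra.
- by move=> a x; rewrite /p mulr_sumr; apply: eq_bigr => i _; rewrite SZ nmZ.
- move=> x y; rewrite /p -big_split /=; apply: ler_sum => i _.
  by rewrite SD nmD.
Qed.

End ClosedGraph.

(** * Uniform choices on discs of the complex plane *)

Section Disc.
Context {R : realType}.

Lemma modulus_le_ReIm (a b : R) : modulus (a +i* b) <= `|a| + `|b|.
Proof.
rewrite /modulus normc_def /= -[X in _ <= X]ger0_norm ?addr_ge0 //.
rewrite -sqrtr_sqr ler_wsqrtr // sqrrD !real_normK ?num_real //.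
by rewrite addrAC lerDl mulrn_wge0 // mulr_ge0.
Qed.

Lemma Re_le_modulus (a : R[i]) : `|complex.Re a| <= modulus a.
Proof.
by rewrite /modulus normc_def /= -sqrtr_sqr ler_wsqrtr // lerDl sqr_ge0.
Qed.

Lemma Im_le_modulus (a : R[i]) : `|complex.Im a| <= modulus a.
Proof.
by rewrite /modulus normc_def /= -sqrtr_sqr ler_wsqrtr // lerDr sqr_ge0.
Qed.

(** The disc lies in a compact square, so finitely many of the local values of [k] suffice, and
    monotonicity allows taking their maximum. *)
Lemma disc_locally_uniform (P : nat -> R[i] -> Prop) :
  (forall k l a, (k <= l)%N -> P k a -> P l a) ->
  (forall a, exists k, exists2 d : R, 0 < d &
     forall b, modulus (b - a) < d -> P k b) ->
  forall M : R, exists k, forall a, modulus a <= M -> P k a.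
Proof.
move=> mono loc M.
have cM : compact (`[- M, M] `*` `[- M, M] : set (R * R)).
  by apply: compact_setX; exact: segment_compact.
have := (compact_near_coveringP _).1 cM nat \oo
  (fun k z => P k (z.1 +i* z.2)) _.
case.
  move=> [a b] _ /=; have [k [d d0 hd]] := loc (a +i* b).
  exists (ball (a, b) (d / 2), [set l | (k <= l)%N]).
    split; first by apply: nbhsx_ballx; rewrite divr_gt0.
    by exists k.
  move=> [[a' b'] l] /= [[ha hb] kl]; apply: (mono k) => //; apply: hd.
  have -> : a' +i* b' - a +i* b = (a' - a) +i* (b' - b) by [].
  apply: le_lt_trans (modulus_le_ReIm _ _) _.
  move: ha hb; rewrite /ball /= (distrC a) (distrC b); lra.
move=> k _ hk; exists k => a aM.
have := hk k (leqnn k) (complex.Re a, complex.Im a).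
case: a aM => a b aM /=; apply.
have := Re_le_modulus (a +i* b); have := Im_le_modulus (a +i* b).
rewrite /= !ler_norml => /andP[h1 h2] /andP[h3 h4].
by split; rewrite /= in_itv /=; apply/andP; split; lra.
Qed.

End Disc.

(** * Non-emptiness of the spectrum *)

Section Spectrum.
Context {R : realType} {X : completeNormedModType R[i]}.

Lemma iter_bounded (T : X -> X) (C : R) N : 0 <= C ->
  (forall x, nm (T x) <= C * nm x) ->
  forall x, nm (iter N T x) <= C ^+ N * nm x.
Proof.
move=> C0 hC x; elim: N => [|N IH] /=; first by rewrite expr0 mul1r.
by apply: le_trans (hC _) _; rewrite exprS -mulrA ler_wpM2l.
Qed.

Lemma root_of_minus_one N : (0 < N)%N ->
  exists2 eta : R[i], eta ^+ N = -1 & modulus eta = 1.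
Proof.
move=> N0; exists (N.-root (-1)); first by rewrite rootCK.
apply/eqP; rewrite -(@pexpr_eq1 _ _ N) ?modulus_ge0 //.
by rewrite -modulusX rootCK // modulusN modulus1.
Qed.

(* [G l] plays the role of the operator l^N (l^N - P)^-1, where P = T^N. *)
Definition power_resolvent (M L : R) (N : nat) (P : X -> X)
    (G : R[i] -> X -> X) :=
  [/\ forall l x, l ^+ N *: G l x - P (G l x) = l ^+ N *: x,
      forall l x, G l (l ^+ N *: x - P x) = l ^+ N *: x,
      forall l k x, modulus l <= M -> modulus k <= M ->
        nm (G l x - G k x) <= L * modulus (l - k) * nm x
    & forall x, G 0 x = 0].

(* The partial fraction 1/(1 - z^2) = (1/(1 - z) + 1/(1 + z))/2, where
   1/(1 + z) is obtained from 1/(1 - z) by rotating the parameter. It keeps the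
   Lipschitz constant of G. *)
Lemma power_resolvent_double M L N P G : (0 < N)%N -> linear P ->
  power_resolvent M L N P G ->
  exists G', power_resolvent M L (2 * N) (P \o P) G'.
Proof.
move=> N0 P_lin [G_right G_left G_lip G0].
have PB := linear_subE P_lin; have PZ := linear_scaleE P_lin.
have PD := linear_addE P_lin.
have PN x : P (- x) = - P x by rewrite -scaleN1r PZ scaleN1r.
have [eta etaN meta] := root_of_minus_one N0.
have two_neq0 : (2 : R[i]) != 0 by rewrite pnatr_eq0.
have half (x : X) : 2^-1 *: (x + x) = x.
  by rewrite -[x + x]/(x *+ 2) -[x *+ 2]scaler_nat scalerA mulVf // scale1r.
(* Replacing [l] by [eta * l] changes the sign of [l ^+ N], so [G (eta * l)] acts as [l ^+ N] times
   the inverse of [l ^+ N + P]. *)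
have G_right' l x : l ^+ N *: G (eta * l) x + P (G (eta * l) x) = l ^+ N *: x.
  have := G_right (eta * l) x.
  rewrite exprMn etaN mulN1r !scaleNr -opprD.
  by move/oppr_inj.
have G_left' l x : G (eta * l) (l ^+ N *: x + P x) = l ^+ N *: x.
  have := G_left (eta * l) (- x); rewrite exprMn etaN mulN1r scaleNr scalerN.
  by rewrite PN !opprK.
exists (fun l x => 2^-1 *: (G l x + G (eta * l) x)); split.
- move=> l x; rewrite mulnC exprM expr2.
  set a := l ^+ N; set y := G l x; set z := G (eta * l) x.
  have y1 := G_right l x; have z1 := G_right' l x.
  rewrite -/a -/y -/z in y1 z1.
  have Py : P y = a *: y - a *: x by rewrite -y1 opprB addrCA subrr addr0.
  have Pz : P z = a *: x - a *: z by rewrite -z1 addrAC subrr add0r.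
  have PPyz : P (P (y + z)) =
      (a * a) *: (y + z) - ((a * a) *: x + (a * a) *: x).
    rewrite PD PD Py Pz !PB !PZ Py Pz !scalerBr !scalerA scalerDr !opprD opprK.
    by rewrite !addrA subrK [LHS](ACl (1*4*2*3))%AC.
  rewrite /= !PZ PPyz scalerA [_ * 2^-1]mulrC -[(2^-1 * _) *: _]scalerA.
  rewrite -scalerBr subKr.
  exact: half.
- move=> l x; rewrite mulnC exprM expr2 /=.
  set a := l ^+ N.
  have e1 : (a * a) *: x - P (P x) = a *: (a *: x + P x) - P (a *: x + P x).
    by rewrite PD PZ scalerDr scalerA opprD addrA addrK.
  have e2 : (a * a) *: x - P (P x) = a *: (a *: x - P x) + P (a *: x - P x).
    by rewrite PB PZ scalerBr scalerA addrA subrK.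
  rewrite {1}e1 e2 G_left G_left' -scalerDr addrACA subrr addr0.
  by rewrite scalerDr scalerA half.
- move=> l k x lM kM; rewrite -scalerBr nmZ modulus_half.
  have el : modulus (eta * l) <= M by rewrite modulusM meta mul1r.
  have ek : modulus (eta * k) <= M by rewrite modulusM meta mul1r.
  have := G_lip _ _ x lM kM; have := G_lip _ _ x el ek.
  rewrite -mulrBr modulusM meta mul1r.
  have := nmD (G l x - G k x) (G (eta * l) x - G (eta * k) x).
  rewrite (_ : G l x - G k x + _ =
    G l x + G (eta * l) x - (G k x + G (eta * k) x)); last first.
    by rewrite opprD addrACA.
  lra.
- by move=> x; rewrite mulr0 !G0 addr0 scaler0.
Qed.

(** Doubling reaches only exponents that are powers of two, which suffices for the limit; [M] and
    [L] are the same for all [m]. *)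
Lemma power_resolvent_exists M L (T : X -> X) G : linear T ->
  power_resolvent M L 1 T G ->
  forall m, exists G', power_resolvent M L (2 ^ m) (iter (2 ^ m) T) G'.
Proof.
move=> T_lin hG; elim=> [|m [G' hG']]; first by exists G.
have [G'' hG''] :=
  power_resolvent_double (expn_gt0 2 m) (iter_linear _ T_lin) hG'.
exists G''; rewrite expnS.
suff -> : iter (2 * 2 ^ m) T = iter (2 ^ m) T \o iter (2 ^ m) T by [].
by apply/funext => x; rewrite mul2n -addnn iterD.
Qed.

Lemma power_lt (s t : R) : 0 < s < t -> exists m0, forall m, (m0 <= m)%N ->
  s ^+ (2 ^ m) <= 1 / 8 * t ^+ (2 ^ m).
Proof.
move=> /andP[s0 st].
have t0 : 0 < t := lt_trans s0 st.
have q0 : 0 <= s / t by rewrite divr_ge0 ?ltW.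
have q1 : s / t < 1 by rewrite ltr_pdivrMr // mul1r.
have : (fun k => (s / t) ^+ k) @ \oo --> (0 : R).
  by apply: cvg_expr; rewrite ger0_norm.
move/cvgrPdist_lt => /(_ (1 / 8)); case; first by lra.
move=> k _ hk; exists k => m km.
have := hk (2 ^ m)%N; rewrite /= sub0r normrN ger0_norm ?exprn_ge0 //.
have -> : (k <= 2 ^ m)%N by apply: leq_trans km _; rewrite ltnW // ltn_expl.
move=> /(_ isT); rewrite expr_div_n ltr_pdivrMr ?exprn_gt0 //.
exact: ltW.
Qed.

(** The radius [s] at which [T^N] is small against [s^N] is lowered from [M] in steps [d / 2], until
    the parameter 0 is within reach and [G 0 = 0] contradicts nearness to the identity at [e]. *)
Lemma spectrum_nonempty (T : X -> X) (C : R) (r : R[i] -> X -> X) (e : X) :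
  linear T -> 0 <= C -> (forall x, nm (T x) <= C * nm x) ->
  (forall l x, l *: r l x - T (r l x) = x) ->
  (forall l x, r l (l *: x - T x) = x) ->
  (forall l, exists2 B, 0 <= B & forall x, nm (r l x) <= B * nm x) ->
  e != 0 -> False.
Proof.
move=> T_lin C0 TC r_right r_left r_bd e0.
have TB := linear_subE T_lin; have TZ := linear_scaleE T_lin.
have r_diff l k x : r l x - r k x = r l ((k - l) *: r k x).
  rewrite -[LHS](r_left l); congr (r l _).
  rewrite TB scalerBr opprD addrACA r_right -{1}[x](r_right k) opprK.
  by rewrite [- _ + T _]addrC addrA subrK -scalerBl.
pose M := C + 1.
have [k0 hk0] : exists B : nat, forall l, modulus l <= M ->
    forall x, nm (r l x) <= B%:R * nm x.
  apply: disc_locally_uniform.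
    move=> k l a kl hk x; apply: le_trans (hk x) _.
    by rewrite ler_wpM2r ?nm_ge0 // ler_nat.
  move=> a; have [B B0 hB] := r_bd a.
  have B1 : 0 < 2 * B + 1 by lra.
  (* Within this radius [B * modulus (b - a)] is at most 1/2, so half of the norm of [r b x] is
     absorbed and the bound [2 * B] remains. The added 1 allows [B = 0]. *)
  exists (Num.truncn (2 * B)).+1; exists (1 / (2 * B + 1)).
    by rewrite divr_gt0.
  move=> b; rewrite ltr_pdivlMr // => hb x.
  have hn : 2 * B <= (Num.truncn (2 * B)).+1%:R.
    exact/ltW/truncnS_gt.
  have h1 : nm (r b x) <= 2 * B * nm x.
    have := hB ((b - a) *: r b x); rewrite -r_diff nmZ.
    have := hB x.
    have := nmD (r a x - r b x) (- r a x).
    rewrite addrAC subrr add0r !nmN.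
    have hBm : B * modulus (b - a) <= 1 / 2 by have := modulus_ge0 (b - a); lra.
    have := ler_wpM2r (nm_ge0 (r b x)) hBm; lra.
  apply: le_trans h1 _; rewrite ler_wpM2r ?nm_ge0 //.
set B := k0%:R : R in hk0.
have B0 : 0 <= B by rewrite ler0n.
have M0 : 0 < M by rewrite /M; lra.
(* A Lipschitz constant for [l *: r l x]: [M * B * B] comes from the difference of resolvents, [B]
   from the difference of the scalar factors. *)
pose L := M * B * B + B.
have L0 : 0 <= L by rewrite addr_ge0 // !mulr_ge0 // ltW.
have G1 : power_resolvent M L 1 T (fun l x => l *: r l x).
  split.
  - by move=> l x; rewrite expr1 TZ -scalerBr r_right.
  - by move=> l x; rewrite expr1 r_left.
  - move=> l k x lM kM.
    have -> : l *: r l x - k *: r k x = l *: (r l x - r k x) + (l - k) *: r k x.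
      by rewrite scalerBr scalerBl addrA subrK.
    apply: le_trans (nmD _ _) _; rewrite r_diff !nmZ.
    have := hk0 l lM ((k - l) *: r k x); rewrite nmZ.
    have h2 := hk0 k kM x.
    rewrite -[modulus (k - l)]modulusN opprB => h1.
    have h3 := ler_wpM2l (modulus_ge0 (l - k)) h2.
    have h4 := le_trans h1 (ler_wpM2l B0 h3).
    have := ler_pM (modulus_ge0 _) (nm_ge0 _) lM h4.
    rewrite /L; lra.
  - by move=> x; rewrite scale0r.
have hG := power_resolvent_exists T_lin G1.
pose D s := exists m0, forall m, (m0 <= m)%N -> forall x,
  nm (iter (2 ^ m) T x) <= 1 / 8 * s ^+ (2 ^ m) * nm x.
(* Inside the disc, moving the parameter by at most [d] moves [G l x] by at most a quarter of
   [nm x], whatever the exponent. *)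
pose d := 1 / (4 * L + 1).
have d0 : 0 < d by rewrite divr_gt0 //; lra.
have dL : L * d <= 1 / 4.
  rewrite /d mulrA ler_pdivrMr ?mulr1; lra.
have weakD (s t : R) : 0 < s < t -> (exists m0, forall m, (m0 <= m)%N ->
    forall x, nm (iter (2 ^ m) T x) <= s ^+ (2 ^ m) * nm x) -> D t.
  move=> st [m0 h0]; have [m1 h1] := power_lt st.
  exists (maxn m0 m1) => m; rewrite geq_max => /andP[m0m m1m] x.
  by apply: le_trans (h0 m m0m x) _; rewrite ler_wpM2r ?nm_ge0 // h1.
(* With [N = 2 ^ m], the identity [s^N (G x - x) = T^N (G x)] at [s] and [D s] give
   [nm (G x - x) <= 1 / 7 * nm x]; moving to [t] adds 1/4, and the total is below 1/2. *)
have near_id (s t : R) : 0 < s -> s <= M -> 0 <= t -> t <= s -> s - t <= d ->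
    D s -> exists m0, forall m, (m0 <= m)%N -> forall G,
    power_resolvent M L (2 ^ m) (iter (2 ^ m) T) G ->
    forall x, nm (G t%:C x - x) <= 1 / 2 * nm x.
  move=> s0 sM t0 ts std [m0 hm0]; exists m0 => m m0m G [G_right _ G_lip _] x.
  have ms : modulus s%:C = s by rewrite modulus_real gtr0_norm.
  have mt : modulus t%:C = t by rewrite modulus_real ger0_norm.
  have := G_lip s%:C t%:C x; rewrite ms mt => /(_ sM (le_trans ts sM)).
  rewrite -rmorphB modulus_real ger0_norm ?subr_ge0 // => lip.
  have lip' : nm (G s%:C x - G t%:C x) <= 1 / 4 * nm x.
    apply: le_trans lip _; rewrite ler_wpM2r ?nm_ge0 //.
    by apply: le_trans dL; rewrite ler_wpM2l.
  have sN : 0 < s ^+ (2 ^ m) by rewrite exprn_gt0.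
  have := hm0 m m0m (G s%:C x).
  have <- : s%:C ^+ (2 ^ m) *: (G s%:C x - x) = iter (2 ^ m) T (G s%:C x).
    rewrite scalerBr -(G_right s%:C x) opprB addrCA subrr addr0 //.
  rewrite nmZ modulusX ms [1 / 8 * _]mulrC -[_ * (1 / 8) * _]mulrA ler_pM2l //.
  have := nmD (G s%:C x - x) x; rewrite subrK.
  have := nmBD (G t%:C x) (G s%:C x) x; rewrite [nm (G t%:C x - G s%:C x)]nmB.
  have := nm_ge0 x.
  lra.
(* At [t = s - d] the operator [G] is within 1/2 of the identity and [G z = x], so
   [nm (x - z) <= nm x], which bounds [T^N] by [t^N]. Raising [t] by [d / 2] restores the factor
   1/8. *)
have step (s : R) : d < s -> s <= M -> D s -> D (s - d / 2).
  move=> ds sM Ds; have s0 := lt_trans d0 ds.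
  apply: (weakD (s - d)); first by apply/andP; split; lra.
  have [|||m0 hm0] := near_id s (s - d) s0 sM _ _ _ Ds; try lra.
  exists m0 => m m0m x; have [G hGm] := hG m.
  have Gx := hm0 m m0m G hGm.
  case: hGm => G_right G_left _ _.
  set t := s - d in Gx *.
  have t0 : 0 < t by rewrite /t; lra.
  have mt : modulus t%:C = t by rewrite modulus_real gtr0_norm.
  have tN : 0 < t ^+ (2 ^ m) by rewrite exprn_gt0.
  have tC0 : t%:C ^+ (2 ^ m) != 0.
    by rewrite -rmorphXn (inj_eq (@complexI _)) gt_eqF.
  pose z := x - (t%:C ^+ (2 ^ m))^-1 *: iter (2 ^ m) T x.
  have Gz : G t%:C z = x.
    have := G_left t%:C ((t%:C ^+ (2 ^ m))^-1 *: x).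
    by rewrite (linear_scaleE (iter_linear _ T_lin)) scalerA mulfV // scale1r.
  have xz : x - z = ((t ^+ (2 ^ m))^-1)%:C *: iter (2 ^ m) T x.
    by rewrite /z subKr fmorphV rmorphXn.
  have := Gx z; rewrite Gz => hxz.
  have : nm (x - z) <= nm x.
    by have := nmBD z x 0; rewrite !subr0 [nm (z - x)]nmB; lra.
  rewrite xz nmZ modulus_real gtr0_norm ?invr_gt0 // mulrC.
  by rewrite ler_pdivrMr // mulrC.
have stop (s : R) : 0 < s -> s <= d -> s <= M -> D s -> False.
  move=> s0 sd sM Ds.
  have [|m0 hm0] := near_id s 0 s0 sM (lexx _) (ltW s0) _ Ds; first lra.
  have [G hGm] := hG m0.
  have := hm0 m0 (leqnn _) G hGm e.
  case: hGm => _ _ _ G0; rewrite G0 sub0r nmN.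
  have := nm_gt0 e0; lra.
have DM : D M.
  (* The margin 1/2 gives a radius strictly below [M] that is positive even if [C = 0]. *)
  apply: (weakD (C + 1 / 2)); first by apply/andP; rewrite /M; split; lra.
  exists 0%N => m _ x; apply: le_trans (iter_bounded _ C0 TC x) _.
  rewrite ler_wpM2r ?nm_ge0 // lerXn2r ?nnegrE //; lra.
have desc k s : 0 < s -> s <= M -> s <= k%:R * (d / 2) -> D s -> False.
  elim: k s => [|k IH] s s0 sM.
    by rewrite mul0r => /le_lt_trans/(_ s0); rewrite ltxx.
  move=> sk Ds; have [sd|ds] := leP s d; first exact: (stop s).
  apply: (IH (s - d / 2)); last exact: step.
  - lra.
  - lra.
  - move: sk; rewrite -natr1; lra.
apply: (desc (Num.truncn (M / (d / 2))).+1 M) => //.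
have d20 : 0 < d / 2 by lra.
by rewrite -ler_pdivrMr //; apply/ltW; exact: truncnS_gt.
Qed.

End Spectrum.

(** * Operator ranges *)

Section PointwiseTopology.
Context {R : realType} {X : completeNormedModType R[i]} {n : nat}.

(** Closedness in metric form, so that it can be checked by inequalities between real norms. *)
Definition approx_closed (Z : set X) : Prop :=
  forall x, (forall e : R, 0 < e -> exists2 z, Z z & nm (z - x) < e) -> Z x.

Definition approx_closed_ptws (M : set {ptws 'I_n -> X}) : Prop :=
  forall w, (forall e : R, 0 < e ->
    exists2 v, M v & forall i, nm (v i - w i) < e) -> M w.

Lemma approx_closed_ptws_closed M : approx_closed_ptws M -> closed M.
Proof.
move=> hM w clw; apply: hM => e e0.
have near_w : nbhs w [set v : {ptws 'I_n -> X} | forall i, nm (v i - w i) < e].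
  apply: (@filter_forall _ _
    (fun i (v : {ptws 'I_n -> X}) => nm (v i - w i) < e)
    (nbhs w) (nbhs_filter w)) => i.
  have near_wi : nbhs (w i) [set y : X | nm (y - w i) < e].
    apply/nbhs_ballP; exists e%:C; first by rewrite /= ltcR.
    by move=> y; rewrite -ball_normE /= normE ltcR nmB.
  exact: (@proj_continuous 'I_n (fun=> X) i w _ near_wi).
by have [v [Mv hv]] := clw _ near_w; exists v.
Qed.

Lemma approx_dense (D : set {ptws 'I_n -> X}) :
  (forall w (e : R), 0 < e -> exists2 v, D v & forall i, nm (v i - w i) < e) ->
  dense D.
Proof.
move=> hD O [w Ow] Oo.
have pow0 k : 0 < (1 / 2 : R) ^+ k by apply: exprn_gt0; lra.
have /choice[v hv] : forall k : nat, exists v, D v /\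
    forall i, nm (v i - w i) < (1 / 2) ^+ k.
  by move=> k; have [v Dv hv] := hD w _ (pow0 k); exists v.
have vw : v @ \oo --> (w : {ptws 'I_n -> X}).
  apply/(@pointwise_cvgP (discrete_topology 'I_n) X) => i.
  apply/cvgrPdist_lt => e e0.
  have er : e = (complex.Re e)%:C by rewrite RRe_real // gtr0_real.
  rewrite er in e0 *; rewrite ltcR in e0.
  have [k hk] := geometric_lt 1 e0; rewrite mul1r in hk.
  exists k => // l /= kl; rewrite normE ltcR nmB.
  apply: lt_trans ((hv l).2 i) _; apply: le_lt_trans hk.
  by apply: ler_wiXn2l => //; lra.
have [k _ hk] := vw _ (open_nbhs_nbhs (conj Oo Ow)).
by exists (v k); split; [exact: (hk k (leqnn k))|exact: (hv k).1].
Qed.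

Lemma coordinate_range (M : set {ptws 'I_n -> X}) j :
  approx_closed_ptws M -> linear_subspace M ->
  set_inj M (fun u : {ptws 'I_n -> X} => u j) ->
  injective_operator_range n [set u j | u in M].
Proof.
move=> clM linM injM; exists M, (fun u => u j); split => //.
- exact: approx_closed_ptws_closed.
- split=> //; exists 1 => u _; rewrite mul1r (bigD1 j) //= lerDl.
  by apply: sumr_ge0.
Qed.

(** Placing [Z] in coordinate [i0] with zeros elsewhere turns a range of order one into one of order
    [n]. Taking [S = id] covers closed subspaces; taking [Z] to be [X] covers ranges of injective
    operators. *)
Lemma operator_range (i0 : 'I_n) (Z : set X) (S : X -> X) (C : R) :
  approx_closed Z -> linear_subspace Z -> linear S ->
  (forall x, nm (S x) <= C * nm x) -> set_inj Z S ->
  injective_operator_range n [set S z | z in Z].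
Proof.
move=> clZ [Z0 linZ] linS hC injS.
exists [set u | Z (u i0) /\ forall j, j != i0 -> u j = 0].
exists (fun u => S (u i0)); split.
- apply: approx_closed_ptws_closed => w hw; split.
    by apply: clZ => e e0; have [v [Zv _] hv] := hw e e0; exists (v i0).
  move=> j j0; apply: nm_lt_eq0 => e e0; have [v [_ v0] hv] := hw e e0.
  by have := hv j; rewrite v0 // sub0r nmN.
- split; first by split.
  move=> a u v [Zu u0] [Zv v0]; split; first exact: linZ.
  move=> j j0; have : a *: u j + v j = 0; last by [].
  by rewrite (u0 _ j0) (v0 _ j0) scaler0 addr0.
- split; first by move=> a u v _ _; rewrite -linS.
  exists `|C|%:C => u _.
  apply: (@le_trans _ _ (`|C|%:C * `|u i0|)).
    rewrite !normE -rmorphM lecR; apply: le_trans (hC _) _.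
    by rewrite ler_wpM2r ?nm_ge0 // ler_norm.
  rewrite ler_wpM2l ?lecR // (bigD1 i0) //= lerDl.
  by apply: sumr_ge0.
- move=> u v /set_mem[Zu u0] /set_mem[Zv v0] /injS; rewrite !inE => uv.
  apply/funext => j; have [->|j0] := eqVneq j i0; first exact: uv.
  by rewrite u0 // v0.
- apply/seteqP; split=> [_ [z Zz <-]|_ [u [Zu _] <-]]; last by exists (u i0).
  exists (fun j => if j == i0 then z else 0); rewrite /= ?eqxx //.
  by split=> // j /negbTE ->.
Qed.

(** For [p] off the line, the distance from [a *: e] to [p] is bounded below locally uniformly in
    [a], hence uniformly on the disc of radius [M]; outside that disc it exceeds 1. *)
Lemma approx_closed_span (e : X) : e != 0 ->
  approx_closed [set x | exists a : R[i], x = a *: e].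
Proof.
move=> e0 p hp; apply: contrapT => np; have ne := nm_gt0 e0.
have pow0 k : 0 < (1 / 2 : R) ^+ k by apply: exprn_gt0; lra.
pose M := (nm p + 1) / nm e.
have [|a|k hk] := @disc_locally_uniform _
    (fun k a => (1 / 2) ^+ k <= nm (a *: e - p)) _ _ M; last first.
- have [_ [a ->] ha] := hp _ (pow0 k).
  suff /hk : modulus a <= M by rewrite leNgt ha.
  rewrite /M ler_pdivlMr // -nmZ.
  have := nmD (a *: e - p) p; rewrite subrK.
  have : (1 / 2 : R) ^+ k <= 1 by apply: exprn_ile1; lra.
  lra.
- have h0 : 0 < nm (a *: e - p).
    apply: nm_gt0; rewrite subr_eq0; apply: contra_notN np => /eqP <-.
    by exists a.
  have [k] := geometric_lt 2 h0; exists k.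
  exists (nm (a *: e - p) / (2 * nm e)); first by rewrite divr_gt0 // mulr_gt0.
  move=> b; rewrite ltr_pdivlMr ?mulr_gt0 //.
  have := nmBD (a *: e) (b *: e) p.
  rewrite -scalerBl nmZ -[modulus (a - b)]modulusN opprB; lra.
- move=> k l a kl; apply: le_trans; apply: ler_wiXn2l => //; lra.
Qed.

Lemma approx_closed_ker (S : X -> X) (C : R) : linear S ->
  (forall x, nm (S x) <= C * nm x) -> approx_closed [set x | S x = 0].
Proof.
move=> S_lin SC x hx; apply: nm_lt_eq0 => e e0.
have C1 : 0 < `|C| + 1 by rewrite ltr_wpDl.
have [z Sz xz] := hx (e / (`|C| + 1)) (divr_gt0 e0 C1).
have -> : S x = S (x - z).
  by rewrite (linear_subE S_lin) [S z]Sz subr0.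
rewrite nmB ltr_pdivlMr // in xz.
apply: le_lt_trans xz; apply: le_trans (SC _) _.
rewrite mulrC ler_wpM2l ?nm_ge0 //; have := ler_norm C; lra.
Qed.

Lemma linear_subspace_ker (S : X -> X) : linear S ->
  linear_subspace [set x | S x = 0].
Proof.
move=> S_lin; split.
  exact: linear_0E.
by move=> a u v /= Su Sv; rewrite S_lin Su Sv scaler0 addr0.
Qed.

End PointwiseTopology.

(** * Transitivity *)

Section Transitivity.
Context {R : realType} {X : completeNormedModType R[i]} {n : nat}.
Variable A : set (X -> X).
Hypothesis A_bounded : A `<=` bounded_operator X.
Hypothesis no_range : forall Y : set X, injective_operator_range n Y ->
  invariant_under A Y -> forall y, Y y -> y != 0 -> forall x, Y x.

Let A_linear T : A T -> linear T.
Proof. by move=> /A_bounded[]. Qed.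

Let A_bd T : A T -> exists2 C : R, 0 <= C & forall x, nm (T x) <= C * nm x.
Proof.
move=> /A_bounded[_ [C hC]].
by apply: bounded_real; exists C.
Qed.

(** A form of Schur's lemma. Injectivity of every [Q a] comes first, as it makes the range of [Q a]
    an injective operator range, to which [no_range] applies. *)
Lemma commutant_scalar (i0 : 'I_n) (S : X -> X) (C : R) (e : X) : linear S ->
  (forall x, nm (S x) <= C * nm x) -> (forall T x, A T -> S (T x) = T (S x)) ->
  e != 0 -> exists a : R[i], forall x, S x = a *: x.
Proof.
move=> S_lin SC S_comm e0; apply: contrapT => nonscalar.
pose Q a x : X := a *: x - S x.
have Q_lin a : linear (Q a).
  move=> b x y; rewrite /Q S_lin scalerDr opprD addrACA scalerBr.
  by rewrite !scalerA [a * b]mulrC.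
have QB a := linear_subE (Q_lin a).
have Q_bd a x : nm (Q a x) <= (modulus a + `|C|) * nm x.
  rewrite mulrDl; apply: le_trans (nmD _ _) _; rewrite nmN nmZ lerD2l.
  by apply: le_trans (SC x) _; rewrite ler_wpM2r ?nm_ge0 // ler_norm.
have Q_comm a T x : A T -> Q a (T x) = T (Q a x).
  move=> AT; rewrite /Q S_comm // (linear_subE (A_linear AT)).
  by rewrite (linear_scaleE (A_linear AT)).
have Q_ker a x : Q a x = 0 -> x = 0.
  move=> Qx; apply: contrapT => /eqP x0; apply: nonscalar; exists a => y.
  suff : [set id z | z in [set z | Q a z = 0]] y.
    by case=> z Qz <-; apply/esym/eqP; rewrite -subr_eq0; apply/eqP.
  apply: (no_range _ _ _ x0); last by exists x.
  - apply: (operator_range i0 (C := 1)) => //.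
    + exact: approx_closed_ker (Q_lin a) (Q_bd a).
    + exact: linear_subspace_ker.
    + by move=> z; rewrite mul1r.
  - move=> T AT _ [_ [z Qz <-] <-]; exists (T z) => //=.
    rewrite Q_comm // [Q a z]Qz.
    exact: linear_0E (A_linear AT).
have Q_inj a x y : Q a x = Q a y -> x = y.
  move=> /eqP; rewrite -subr_eq0 -QB => /eqP /Q_ker /eqP.
  by rewrite subr_eq0 => /eqP.
have Q_surj a y : exists x, Q a x = y.
  suff : [set Q a z | z in setT] y by case=> x _ <-; exists x.
  apply: (@no_range _ _ _ (Q a e)).
  - apply: (operator_range i0 (C := modulus a + `|C|)) => //.
    by move=> x z _ _; exact: Q_inj.
  - move=> T AT _ [_ [z _ <-] <-]; exists (T z) => //.
    exact: Q_comm.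
  - by exists e.
  - by apply: contra_neq e0; exact: Q_ker.
have /choice[r hr] : forall ay : R[i] * X, exists x, Q ay.1 x = ay.2.
  by move=> [a y]; exact: Q_surj.
have S_bd x : nm (S x) <= `|C| * nm x.
  by apply: le_trans (SC x) _; rewrite ler_wpM2r ?nm_ge0 // ler_norm.
apply: (@spectrum_nonempty _ _ S `|C| (fun a y => r (a, y)) e) => //.
- by move=> a x; exact: (hr (a, x)).
- by move=> a x; apply: (Q_inj a); exact: (hr (a, _)).
move=> a.
(* The inverse has a closed graph because [Q a] is bounded. *)
have [||B B0 hB] :=
    @closed_graph_bounded _ _ unit (fun _ y => r (a, y)); last first.
- by exists B => // x; exact: (hB tt).
- move=> u x y D E ux ry []; apply: (Q_inj a); rewrite (hr (a, x)) /=.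
  apply/esym/eqP; rewrite -subr_eq0; apply/eqP.
  apply: (@geometric_eq0 _ _ _ ((modulus a + `|C|) * E + D)) => k.
  have := nmBD (Q a (y tt)) (u k) x.
  have -> : nm (Q a (y tt) - u k) = nm (Q a (r (a, u k) - y tt)).
    by rewrite QB (hr (a, u k)) nmB.
  have h1 := Q_bd a (r (a, u k) - y tt).
  have ac : 0 <= modulus a + `|C| by rewrite addr_ge0 // modulus_ge0.
  have h2 := ler_wpM2l ac (ry tt k); have h3 := ux k.
  lra.
- move=> _ b x y; apply: (Q_inj a).
  by rewrite Q_lin (hr (a, _)) (hr (a, x)) (hr (a, y)).
Qed.

Variable x : 'I_n -> X.
Hypothesis A_linsub : linear_subspace A.
Hypothesis A_mul : forall S T, A S -> A T -> A (S \o T).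

Let A0 T : A T -> T 0 = 0.
Proof. by move=> /A_linear /linear_0E. Qed.

Let W : set {ptws 'I_n -> X} :=
  [set w | forall e : R, 0 < e ->
     exists2 T, A T & forall i, nm (T (x i) - w i) < e].

Lemma approx_closed_orbit_closure : approx_closed_ptws W.
Proof.
move=> w hw e e0; have e20 : 0 < e / 2 by rewrite divr_gt0.
have [v Wv vw] := hw _ e20; have [T AT hT] := Wv _ e20.
exists T => // i; have := vw i; have := hT i.
have := nmBD (T (x i)) (v i) (w i); lra.
Qed.

Lemma orbit_mem T : A T -> W (fun i => T (x i)).
Proof. by move=> AT e e0; exists T => // i; rewrite subrr nm0. Qed.

Lemma linear_subspace_orbit_closure : linear_subspace W.
Proof.
have [A_0 A_lin] := A_linsub.
split.
  by move=> e e0; exists 0 => // i; rewrite subrr nm0.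
move=> a u v Wu Wv e e0.
have a1 : 0 < modulus a + 1 by rewrite ltr_wpDl ?modulus_ge0.
have e1 : 0 < e / (modulus a + 1) by rewrite divr_gt0.
have [S AS hS] := Wu _ e1; have [T AT hT] := Wv _ e1.
exists (a *: S + T); first exact: A_lin.
move=> i.
have -> : (a *: S + T) (x i) - (a *: u + v) i =
    a *: (S (x i) - u i) + (T (x i) - v i).
  by rewrite scalerBr addrACA -opprD.
apply: le_lt_trans (nmD _ _) _; rewrite nmZ.
have h1 := ler_wpM2l (modulus_ge0 a) (ltW (hS i)).
have -> : e = modulus a * (e / (modulus a + 1)) + e / (modulus a + 1).
  by rewrite -{2}[e / _]mul1r -mulrDl mulrC divfK // gt_eqF.
have := hT i; lra.
Qed.

Lemma orbit_closure_invariant T w : A T -> W w -> W (fun i => T (w i)).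
Proof.
move=> AT Ww e e0; have [C C0 hC] := A_bd AT.
have C1 : 0 < C + 1 by lra.
have [S AS hS] := Ww _ (divr_gt0 e0 C1).
exists (T \o S); first exact: A_mul.
move=> i /=; rewrite -(linear_subE (A_linear AT)).
apply: le_lt_trans (hC _) _; have := hS i; rewrite ltr_pdivlMr //.
have := nm_ge0 (S (x i) - w i); lra.
Qed.

Lemma orbit_closure_full (e : X) : e != 0 ->
  (forall y, (forall T, A T -> T y = 0) -> y = 0) ->
  linearly_independent x -> forall w, W w.
Proof.
move=> e0 A_ker x_free.
have clW := approx_closed_orbit_closure.
have [W0 W_lin] := linear_subspace_orbit_closure.
have WD u v : W u -> W v -> W (u + v).
  by move=> Wu Wv; rewrite -[u]scale1r; exact: W_lin.
have WB u v : W u -> W v -> W (u - v).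
  by move=> Wu Wv; rewrite addrC -scaleN1r; exact: W_lin.
(* As [W] is a subspace, this trivial kernel is injectivity of the projection of [W] to the
   coordinates in [J]. *)
pose inj (J : {set 'I_n}) :=
  forall w, W w -> (forall i, i \in J -> w i = 0) -> forall i, w i = 0.
have injT : `[< inj [set: 'I_n]%SET >].
  by apply/asboolP => w Ww hw i; apply: hw; rewrite finset.in_setT.
case: (@arg_minnP _ _ (fun J => `[< inj J >]) (fun J : {set 'I_n} => #|J|)
  injT) => J /asboolP injJ minJ.
pose Wj (j : 'I_n) : set {ptws 'I_n -> X} :=
  [set w | W w /\ forall i, i \in J -> i != j -> w i = 0].
have Wj_inj j (u v : {ptws 'I_n -> X}) :
    Wj j u -> Wj j v -> u j = v j -> u = v.
  move=> [Wu u0] [Wv v0] uv; apply/funext => i; apply/eqP.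
  rewrite -subr_eq0; apply/eqP.
  apply: (injJ (u - v) (WB _ _ Wu Wv)) => k kJ.
  have -> : (u - v) k = u k - v k by [].
  have [->|kj] := eqVneq k j; first by rewrite uv subrr.
  by rewrite (u0 _ kJ kj) (v0 _ kJ kj) subrr.
have Wj_lin j : linear_subspace (Wj j).
  split=> [|a u v [Wu u0] [Wv v0]]; first by split.
  split=> [|i iJ ij]; first exact: W_lin.
  have : a *: u i + v i = 0; last by [].
  by rewrite (u0 _ iJ ij) (v0 _ iJ ij) scaler0 addr0.
have Wj_closed j : approx_closed_ptws (Wj j).
  move=> w hw; split.
    by apply: clW => d d0; have [v [Wv _] vw] := hw d d0; exists v.
  move=> i iJ ij; apply: nm_lt_eq0 => d d0; have [v [_ v0] vw] := hw d d0.
  by have := vw i; rewrite (v0 _ iJ ij) sub0r nmN.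
have Wj_invariant j T w : A T -> Wj j w -> Wj j (fun i => T (w i)).
  move=> AT [Ww w0]; split; first exact: orbit_closure_invariant.
  by move=> i iJ ij; rewrite (w0 _ iJ ij) A0.
have Wj_nonzero j : j \in J -> exists2 w, Wj j w & w j != 0.
  move=> jJ; apply: contrapT => Wj0.
  (* If the [j]-th coordinate vanished on [Wj j], removing [j] from [J] would keep injectivity,
     against minimality. *)
  have /minJ : `[< inj (J :\ j)%SET >].
    apply/asboolP => w Ww hw.
    apply: (injJ w Ww) => i iJ; have [ij|ij] := eqVneq i j; last first.
      by apply: hw; rewrite finset.in_setD1 ij.
    apply: contrapT => /eqP wi; apply: Wj0; exists w; last by rewrite -ij.
    by split=> // k kJ kj; apply: hw; rewrite finset.in_setD1 kj.
  by rewrite (cardsD1 j J) jJ ltnn.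
have Wj_surj j y : j \in J -> exists w, Wj j w /\ w j = y.
  move=> jJ; have [w Ww w0] := Wj_nonzero j jJ.
  suff : [set u j | u in Wj j] y by case=> u Wu <-; exists u.
  apply: (@no_range _ _ _ (w j)) => //; last by exists w.
  - apply: coordinate_range => // u v /set_mem Wu /set_mem Wv.
    exact: Wj_inj.
  - move=> T AT _ [_ [u Wu <-] <-]; exists (fun i => T (u i)) => //.
    exact: Wj_invariant.
(* For [j] in [J], [t (j, y)] is the only element of [Wj j] with [j]-th coordinate [y]; this
   uniqueness makes it linear in [y] and compatible with [A]. *)
have /choice[t ht] : forall jy : 'I_n * X, exists w,
    jy.1 \in J -> Wj jy.1 w /\ w jy.1 = jy.2.
  move=> [j y] /=; have [jJ|jJ] := boolP (j \in J); last by exists 0.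
  by have [w hw] := Wj_surj j y jJ; exists w.
(* For arbitrary [w], [s w] is the vector of [W] that agrees with [w] on [J]; it is [w] itself if
   [w] is in [W] or [J] is everything. *)
pose s (w : {ptws 'I_n -> X}) : {ptws 'I_n -> X} :=
  \sum_(j in J) t (j, w j).
have sE w i : s w i = \sum_(j in J) t (j, w j) i.
  by rewrite /s; elim/big_rec2: _ => // j u v _ <-.
have Ws w : W (s w).
  apply: big_ind => // j jJ; exact: (ht (j, w j) jJ).1.1.
have sJ w k : k \in J -> s w k = w k.
  move=> kJ; rewrite sE (bigD1 k) //= (ht (k, w k) kJ).2 big1 ?addr0 //.
  move=> j /andP[jJ jk]; apply: (ht (j, w j) jJ).1.2 => //.
  by rewrite eq_sym.
have sW w : W w -> s w = w.
  move=> Ww; apply/funext => i; apply/eqP; rewrite -subr_eq0; apply/eqP.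
  apply: (injJ (s w - w) (WB _ _ (Ws w) Ww)) => k kJ.
  by have : s w k - w k = 0; last by []; rewrite sJ // subrr.
have [JT|] := boolP (J == [set: 'I_n]%SET).
  move=> w; suff <- : s w = w by [].
  by apply/funext => i; rewrite sJ // (eqP JT) finset.in_setT.
rewrite -finset.subTset => /subsetPn[i _ iJ].
have t_lin j k : j \in J -> linear (fun y => t (j, y) k).
  move=> jJ a y z.
  have [Wy yj] := ht (j, y) jJ; have [Wz zj] := ht (j, z) jJ.
  have [Wyz yzj] := ht (j, a *: y + z) jJ.
  have -> // : t (j, a *: y + z) = a *: t (j, y) + t (j, z).
  apply: (Wj_inj j) => //; first exact: (Wj_lin j).2.
  rewrite /= in yj zj yzj.
  by rewrite yzj -[RHS]/(a *: t (j, y) j + t (j, z) j) yj zj.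
have t_comm j k T y : j \in J -> A T -> t (j, T y) k = T (t (j, y) k).
  move=> jJ AT; have [Wy yj] := ht (j, y) jJ; have [WTy Tyj] := ht (j, T y) jJ.
  suff -> : t (j, T y) = (fun i => T (t (j, y) i)) by [].
  apply: (Wj_inj j) => //; first exact: Wj_invariant.
  by rewrite Tyj /= yj.
(* All coordinates are treated at once: [Wj j] is closed in the power of [X], so the limits of all
   coordinates are needed to recognise [t (j, y)]. *)
have t_bd j : j \in J -> exists2 C : R, 0 <= C &
    forall k y, nm (t (j, y) k) <= C * nm y.
  move=> jJ; apply: closed_graph_bounded; first by move=> k; exact: t_lin.
  move=> u y z C D uy tz.
  suff -> : t (j, y) = z by [].
  have [Wy yj] := ht (j, y) jJ.
  have zE k : k = j -> z k = y.
    move=> ->; apply/eqP; rewrite -subr_eq0; apply/eqP.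
    apply: (@geometric_eq0 _ _ _ (D + C)) => m.
    have := nmBD (z j) (u m) y; have := tz j m; have := uy m.
    have [_ /= ->] := ht (j, u m) jJ; rewrite [nm (u m - z j)]nmB; lra.
  apply: (Wj_inj j) => //; last by rewrite yj zE.
  apply: Wj_closed => d d0.
  have [m hm] := geometric_lt D d0; exists (t (j, u m)).
    exact: (ht (j, u m) jJ).1.
  by move=> k; exact: le_lt_trans (tz k m) hm.
have /choice[a ha] : forall j, exists a : R[i],
    j \in J -> forall y, t (j, y) i = a *: y.
  move=> j; have [jJ|jJ] := boolP (j \in J); last by exists 0.
  have [C C0 hC] := t_bd j jJ.
  have [|T y AT|a ha] := @commutant_scalar i (fun y => t (j, y) i) C e _
    (hC i) _ e0; last by exists a.
  - exact: t_lin.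
  - exact: t_comm.
(* [s] fixes the orbit vector of [T]; in coordinate [i] this says that [T (x i)] is the sum of the
   [a j *: T (x j)] over [J]. So every [T] in [A] kills this difference. *)
have xi : x i - \sum_(j in J) a j *: x j = 0.
  apply: A_ker => T AT; have TB := linear_subE (A_linear AT).
  have TZ := linear_scaleE (A_linear AT).
  have TD := linear_addE (A_linear AT).
  rewrite TB (big_morph T TD (A0 AT)).
  have := sW _ (orbit_mem AT) => /(congr1 (fun w => w i)).
  rewrite sE => <-; apply/eqP; rewrite subr_eq0; apply/eqP.
  by apply: eq_bigr => j jJ; rewrite ha // TZ.
pose c k : R[i] := if k == i then 1 else if k \in J then - a k else 0.
have := x_free c; rewrite (bigD1 i) //= {1}/c eqxx scale1r.
have -> : \sum_(k | k != i) c k *: x k = - \sum_(j in J) a j *: x j.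
  rewrite -sumrN [RHS]big_mkcond [LHS]big_mkcond; apply: eq_bigr => k _ /=.
  have [->|ki] /= := eqVneq k i; first by rewrite (negbTE iJ).
  rewrite /c (negbTE ki); case: (k \in J); last by rewrite scale0r.
  by rewrite scaleNr.
move=> /(_ xi i) /eqP; by rewrite /c eqxx oner_eq0.
Qed.

End Transitivity.

(** * The dichotomy *)

(** If [x i = a *: e] and [x j = b *: e], the relation [b *: x i - a *: x j = 0] forces [a = 0], and
    then [x i = 0] is itself a relation. *)
Lemma one_dimensional_dependent (R : realType) (X : normedModType R[i])
    (n : nat) (x : 'I_n -> X) :
  (1 < n)%N -> one_dimensional X -> ~ linearly_independent x.
Proof.
move=> n1 [e e0 he] x_free.
have n0 : (0 < n)%N by exact: ltnW.
have [i [j ji]] : exists i j : 'I_n, j != i.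
  by exists (Ordinal n0), (Ordinal n1).
have [a xi] := he (x i); have [b xj] := he (x j).
have sumE (c d : R[i]) : \sum_k (if k == i then c else if k == j then d else 0)
    *: x k = (c * a + d * b) *: e.
  rewrite (bigD1 i) //= (bigD1 j) //= eqxx (negbTE ji) eqxx big1 ?addr0.
    by rewrite xi xj !scalerA -scalerDl.
  by move=> k /andP[/negbTE-> /negbTE->]; rewrite scale0r.
have := sumE b (- a); rewrite mulrC mulNr subrr scale0r => /x_free h.
have a0 := h j; rewrite (negbTE ji) eqxx in a0.
have := sumE 1 0; rewrite mul1r mul0r addr0.
move/eqP: a0; rewrite oppr_eq0 => /eqP ->; rewrite scale0r => /x_free /(_ i).
by rewrite eqxx => /eqP; rewrite oner_eq0.
Qed.

Unset Implicit Arguments.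
Set Strict Implicit.
Set Printing Implicit Defensive.

Theorem theorem4p2 (R : realType) (X : completeNormedModType R[i])
    (A : set (X -> X)) (n : nat)
    (A_subalgebra : is_subalgebra A)
    (n_ge1 : (1 <= n)%N)
    (A_nondegenerate : ~ degenerate n A) :
  (exists Y : set X,
      [/\ injective_operator_range n Y, invariant_under A Y & nontrivial Y])
  \/ n_transitive n A.
Proof.
have [A_bounded A_linsub A_mul] := A_subalgebra.
apply/or_asboolP; case: asboolP => //= noY; apply/asboolP => x x_free.
pose i0 : 'I_n := Ordinal n_ge1.
have no_range (Y : set X) : injective_operator_range n Y ->
    invariant_under A Y -> forall y, Y y -> y != 0 -> forall z, Y z.
  move=> rangeY invY y Yy y0 z; apply: contrapT => Yz; apply: noY.
  exists Y; split=> //; split=> YE; last by apply: Yz; rewrite YE.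
  by move: Yy y0; rewrite YE => -> /eqP.
have e0 : x i0 != 0.
  apply/eqP => x0.
  have := x_free (fun k => if k == i0 then 1 else 0); rewrite (bigD1 i0) //=.
  rewrite x0 scaler0 add0r big1 => [/(_ erefl i0)|k /negbTE ->].
    by rewrite eqxx => /eqP; rewrite oner_eq0.
  by rewrite scale0r.
have id_bd (y : X) : nm (id y) <= 1 * nm y by rewrite mul1r.
have A_0 T : A T -> T 0 = 0.
  by move=> /A_bounded[/linear_0E].
(* If [y] is nonzero, the common kernel, a closed invariant subspace, is all of [X], so every
   operator in [A] is zero. Then the line through [y] is invariant and [X] is one-dimensional. *)
have A_ker y : (forall T, A T -> T y = 0) -> y = 0.
  move=> Ay; apply: contrapT => /eqP y0.
  have AE T z : A T -> T z = 0.
    move=> AT.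
    suff : [set id z | z in [set z | forall T, A T -> T z = 0]] z.
      by case=> w hw <-; exact: hw.
    apply: (no_range _ _ _ y) => //; last by exists y.
    - apply: (operator_range i0 (C := 1)) => //.
      + move=> w hw S AS; have [S_lin [C hC]] := A_bounded S AS.
        have [|c _ hc] := @bounded_real _ _ S; first by exists C.
        apply: (approx_closed_ker S_lin hc).
        by move=> d d0; have [v hv vw] := hw d d0; exists v => //; exact: hv.
      + split=> [S AS|a u v hu hv S AS]; first exact: A_0.
        by have [S_lin _] := A_bounded S AS; rewrite S_lin hu // hv // scaler0
          addr0.
    - move=> S AS _ [_ [w hw <-] <-]; exists 0; last by rewrite /= hw.
      by move=> U AU; exact: A_0.
  have one_dim : one_dimensional X.
    exists y => // z.
    suff : [set id z | z in [set z | exists a : R[i], z = a *: y]] z.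
      by case=> w [a ->] <-; exists a.
    apply: (no_range _ _ _ y) => //; last first.
      by exists y => //; exists 1; rewrite scale1r.
    - move=> T AT _ [_ [w _ <-] <-]; exists 0; last by rewrite /= AE.
      by exists 0; rewrite scale0r.
    - apply: (operator_range i0 (C := 1)) => //.
      + exact: approx_closed_span.
      + split=> [|a _ _ [b ->] [c ->]]; first by exists 0; rewrite scale0r.
        by exists (a * b + c); rewrite scalerDl scalerA.
  (* For [n > 1] dimension one contradicts the independence of [x]; for [n = 1] this is the excluded
     degenerate case. *)
  case: (ltngtP n 1) (n_ge1) => // [n_gt1 _|n1 _].
    exact: one_dimensional_dependent n_gt1 one_dim x_free.
  apply: A_nondegenerate; split=> //; apply/seteqP; split=> [T AT|_ ->].
    by apply/funext => z; exact: AE.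
  exact: A_linsub.1.
apply: approx_dense => w e e_gt0.
have [T AT hT] := orbit_closure_full A_bounded no_range A_linsub A_mul e0 A_ker
  x_free w e_gt0.
by exists (fun i => T (x i)) => //; exists T.
Qed.
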